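(* Let $p$ be a prime number, let $k \geq 2$ be an integer with $k - 1 = \langle e_0, \ldots, e_t \rangle_p$, and let $x \geq (k-1)p$ be a real number. Then the inequality $$\nu_p(H(n,k)) < -(k-1)\big(\log_p n - \log_p(k-1) - 1\big)$$ holds for all integers $n \in [(k-1)p, x]$ whose base-$p$ representation has the form $n = \langle e_0, \ldots, e_t, d_{t+1}, \ldots, d_s \rangle_p$ (i.e., starts with the base-$p$ digits of $k-1$), with at most $3x^{0.835}$ exceptions.
   Context: For integers $n \geq k \geq 1$, $H(n,k) := \sum_{1 \leq i_1 < \cdots < i_k \leq n} \frac{1}{i_1 \cdots i_k}$. $\nu_p$ denotes the $p$-adic valuation on the rationals. For a prime $p$, $\langle a_0, \ldots, a_v \rangle_p := \sum_{i=0}^v a_i p^{v-i}$ denotes a base-$p$ representation, with $a_0, \ldots, a_v \in \{0, \ldots, p-1\}$ and $a_0 \neq 0$. *)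

(* Defs.v *)
From HB Require Import structures.
From mathcomp Require Import all_boot all_order all_algebra.
From mathcomp Require Import all_classical all_reals all_analysis.
Set Implicit Arguments. Unset Strict Implicit. Unset Printing Implicit Defensive.
Import Order.TTheory GRing.Theory Num.Theory.
Local Open Scope ring_scope.

(* H(n,k) = sum over 1 <= i_1 < ... < i_k <= n of 1/(i_1 ... i_k),
   as a sum over k-element subsets of {0,...,n-1} (index i stands for i+1). *)
Definition H (n k : nat) : rat :=
  \sum_(S : {set 'I_n} | #|S| == k) \prod_(i in S) ((nat_of_ord i).+1%:R)^-1.

(* p-adic valuation of a rational (nu_p 0 = 0 by convention; unused here). *)
Definition nu_p (p : nat) (q : rat) : int :=
  (logn p `|numq q|%N)%:Z - (logn p `|denq q|%N)%:Z.

(* base-p digits of n, most significant first; digits p 0 = [::]. *)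
Fixpoint digits_rec (fuel p n : nat) : seq nat :=
  if fuel is f.+1 then
    if n == 0%N then [::] else rcons (digits_rec f p (n %/ p)%N) (n %% p)%N
  else [::].
Definition digits (p n : nat) : seq nat := digits_rec n p n.

Definition logb {R : realType} (p : nat) (y : R) : R := ln y / ln (p%:R).

(* Main.v *)
(* Put m = k - 1. The digit condition says n %/ p^r = m for some r, and the
   inequality can fail only if A_r(n) := m! p^(r m) H(n, k) lies in p Z_(p).
   Write n = p n' + d. Splitting prod_(i <= n) (1 + X/i) into the i prime to p
   and the multiples of p, and using that m! p^(r m) H(n, m) = 1 mod p, one finds
   that A_r(n) in p Z_(p) forces both A_(r-1)(n') in p Z_(p) and
     sum_(i <= n, p not dividing i) 1/i = - A_(r-1)(n') / p  (mod p).
   So the exceptional n form a tree in which the children of n' are digits d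
   sharing one residue of this sum. Two such digits at distance j make d a root
   mod p of the derivative of (X+1)...(X+j), of degree j - 1, so the distance j
   occurs at most j - 1 times. Digits spread out in this way number at most
   f <= p^(5/6), and summing f^r over the r with p^r <= x gives at most
   3 x^(5/6) <= 3 x^0.835 exceptions. *)
Require Import Defs.
From HB Require Import structures.
From mathcomp Require Import all_boot all_order all_algebra.
From mathcomp Require Import all_classical all_reals all_analysis.
From mathcomp Require Import zify ring lra.
Import Order.TTheory GRing.Theory Num.Theory.
Local Open Scope ring_scope.

(** * The local ring Z_(p) inside the rationals *)

(** A congruence of [a] and [b] mod [p] is expressed below as [(a - b) / p%:R \in plocal p]. *)
Definition plocal (p : nat) : {pred rat} := [pred q | coprime p `|denq q|].

(** Any denominator prime to [p] serves as a witness, not only the reduced one, so sums and products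
    need no reduction of fractions. *)
Lemma plocalP (p : nat) (q : rat) :
  reflect (exists2 b : nat, coprime p b & exists z : int, q * b%:R = z%:~R)
          (q \in plocal p).
Proof.
apply: (iffP idP) => [pq|[b pb [z qb]]].
  exists `|denq q|%N => //; exists (numq q).
  by rewrite -{1}(divq_num_den q) natr_absz gtr0_norm ?denq_gt0// divfK//
             intr_eq0 denq_neq0.
rewrite inE; apply: coprime_dvdr pb.
have e : (numq q * b%:Z = z * denq q)%R.
  apply: (@intr_inj rat); rewrite !rmorphM/= -qb -{2}(divq_num_den q).
  by rewrite mulrAC divfK ?intr_eq0 ?denq_neq0.
have := coprime_num_den q; rewrite coprime_sym => cq.
rewrite -(Gauss_dvdr _ cq); have /(congr1 absz) := e.
by rewrite !abszM/= => ->; rewrite dvdn_mull.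
Qed.

Fact plocal_subring (p : nat) : subring_closed (plocal p).
Proof.
split=> [|q r /plocalP[b pb [z qz]] /plocalP[c pc [w rw]]|
          q r /plocalP[b pb [z qz]] /plocalP[c pc [w rw]]].
- by rewrite inE coprimen1.
- apply/plocalP; exists (b * c)%N; first by rewrite coprimeMr pb.
  exists (z * c - w * b); rewrite rmorphB !rmorphM/= -qz -rw ?natrM -?pmulrn.
  by ring.
- apply/plocalP; exists (b * c)%N; first by rewrite coprimeMr pb.
  by exists (z * w); rewrite !rmorphM/= -qz -rw; ring.
Qed.

HB.instance Definition _ (p : nat) :=
  GRing.isSubringClosed.Build rat (plocal p) (plocal_subring p).

Lemma plocal_inv (p i : nat) : coprime p i -> i%:R^-1 \in plocal p.
Proof.
move=> pi; apply/plocalP; exists i => //.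
have [->|i0] := eqVneq i 0%N; first by exists 0; rewrite mulr0.
by exists 1; rewrite mulVf// pnatr_eq0.
Qed.

Lemma plocal_nat_div (p n : nat) : prime p ->
  n%:R / p%:R \in plocal p -> (p %| n)%N.
Proof.
move=> pp /plocalP[b pb [z e]].
have p0 : (p%:R != 0 :> rat) by rewrite pnatr_eq0; case: p pp {pb e}.
have e2 : ((n * b)%N%:Z = z * p%:Z)%R.
  apply: (@intr_inj rat); rewrite [RHS]rmorphM/= -e -!pmulrn natrM.
  by rewrite -mulrA -mulrA [b%:R * _]mulrC mulKf.
rewrite -(Gauss_dvdl _ pb).
by have /(congr1 absz) := e2; rewrite abszM/= => ->; rewrite dvdn_mull.
Qed.

(** * Generating polynomials of [H] and separation of the multiples of [p] *)

(** Expanding the product amounts to choosing a subset of the factors. The scale [c] stays free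
    because the multiples of [p] produce the case [c = 1 / p]. *)
Lemma coef_prod_H (c : rat) (n j : nat) :
  (\prod_(i < n) (1 + (c / i.+1%:R) *: 'X))`_j = c ^+ j * H n j.
Proof.
under eq_bigr do rewrite addrC.
rewrite bigA_distr coef_sum /H mulr_sumr [RHS]big_mkcond; apply: eq_bigr => S _.
have -> : \prod_(i < n) (if i \in S then (c / i.+1%:R) *: 'X else 1) =
          (c ^+ #|S| * \prod_(i in S) (i.+1%:R)^-1) *: 'X^#|S| :> {poly rat}.
  rewrite -big_mkcond/= scaler_prod prodr_const big_split/= prodr_const.
  by [].
by rewrite coefZ coefXn eq_sym; case: eqP => [->|]; rewrite ?mulr1 ?mulr0.
Qed.

(* The factor of [\prod_(i <= n) (1 + X / i)] indexed by the [i] prime to [p]. *)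
Definition copoly (p n : nat) : {poly rat} :=
  \prod_(i < n | ~~ (p %| i.+1)%N) (1 + (i.+1%:R)^-1 *: 'X).

(** An index [i = p * l] contributes [1 + X / (p * l)], where [l] runs up to [n %/ p]. *)
Lemma prod_copoly (p n : nat) : prime p ->
  \prod_(i < n) (1 + (1 / i.+1%:R) *: 'X) =
  copoly p n * \prod_(i < n %/ p) (1 + ((p%:R)^-1 / i.+1%:R) *: 'X) :> {poly rat}.
Proof.
move=> pp; have p0 := prime_gt0 pp; rewrite /copoly.
elim: n => [|n IH]; first by rewrite div0n !big_ord0 mulr1.
rewrite big_ord_recr/= IH [in RHS]big_mkcond big_ord_recr/= -big_mkcond/= divnS//.
have [pn|_] /= := boolP (p %| n.+1)%N; last first.
  by rewrite mulrAC mul1r add0n.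
rewrite mulr1 add1n big_ord_recr/= mulrA; congr (_ * (1 + _ *: _)).
have -> : n.+1 = ((n %/ p).+1 * p)%N.
  by rewrite -[LHS](divnK pn) divnS// pn.
by rewrite natrM invfM mul1r mulrC.
Qed.

Lemma H_rec (p n j : nat) : prime p ->
  H n j = \sum_(i < j.+1) (copoly p n)`_i * (p%:R^-1 ^+ (j - i) * H (n %/ p) (j - i)).
Proof.
move=> pp; have := coef_prod_H 1 n j; rewrite expr1n mul1r => <-.
by rewrite (@prod_copoly p)// coefM; apply: eq_bigr => i _; rewrite coef_prod_H.
Qed.

Lemma copoly_local (p n i : nat) : prime p -> (copoly p n)`_i \in plocal p.
Proof.
move=> pp; have /polyOverP : copoly p n \is a polyOver (plocal p); last by apply.
apply: rpred_prod => k pk; rewrite rpredD ?rpred1// polyOverZ ?polyOverX//.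
by rewrite plocal_inv// prime_coprime.
Qed.

Lemma copoly_coef01 (p n : nat) :
  (copoly p n)`_0 = 1 /\
  (copoly p n)`_1 = \sum_(i < n | ~~ (p %| i.+1)%N) (i.+1%:R)^-1.
Proof.
rewrite /copoly; elim/big_rec2: _ => [|i y s _ [e0 e1]]; first by rewrite !coefE.
rewrite !mulrDl mul1r !coefD -!scalerAl !coefZ !coefXM/= e0 e1 mulr0 addr0.
by split=> //; rewrite mulr1 addrC.
Qed.

(** * Rising factorials *)

Definition rising (R : nzRingType) (n : nat) : {poly R} :=
  \prod_(i < n) ('X + (i.+1%:R)%:P).

Lemma rising_XsubC (R : nzRingType) (n : nat) :
  rising R n = \prod_(i < n) ('X - (- i.+1%:R)%:P).
Proof. by apply: eq_bigr => i _; rewrite polyCN opprK. Qed.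

Lemma risingS (R : nzRingType) (n : nat) :
  rising R n.+1 = rising R n * ('X + (n.+1%:R)%:P).
Proof. exact: big_ord_recr. Qed.

Lemma size_rising (R : nzRingType) (n : nat) : size (rising R n) = n.+1.
Proof.
by rewrite rising_XsubC size_prod_XsubC /index_enum/= -enumT size_enum_ord.
Qed.

Lemma coef_rising (R : nzRingType) (n : nat) : (rising R n)`_n = 1.
Proof.
have /monicP : rising R n \is monic by rewrite rising_XsubC monic_prod_XsubC.
by rewrite /lead_coef size_rising.
Qed.

(** The factor [i] of [m!] turns [1 + X / i] into [X + i]. These coefficients are integers (unsigned
    Stirling numbers), which starts the inductions on [r] below. *)
Lemma fact_H (m j : nat) : m`!%:R * H m j = (rising rat m)`_j.
Proof.
have := coef_prod_H 1 m j; rewrite expr1n mul1r => <-; rewrite -coefZ.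
suff -> : m`!%:R *: \prod_(i < m) (1 + (1 / i.+1%:R) *: 'X) = rising rat m by [].
elim: m => [|m IH]; first by rewrite /rising !big_ord0 scale1r.
rewrite risingS -IH big_ord_recr/= factS mulnC natrM -scalerA -scalerAl.
congr (_ *: _); rewrite scalerAr; congr (_ * _).
rewrite scalerDr scalerA mul1r mulfV ?pnatr_eq0// scale1r addrC.
by rewrite alg_polyC.
Qed.

(** * Divisibility of the scaled sums by [p] *)

(* [H n j] scaled so as to be [p]-integral for [j <= m] when [n %/ p ^ r = m]. *)
Definition scaledH (p m r n j : nat) : rat := m`!%:R * p%:R ^+ (r * m) * H n j.

Lemma scaledH_rec (p m r n j : nat) : prime p ->
  scaledH p m r.+1 n j =
  \sum_(i < j.+1) (copoly p n)`_i * (p%:R ^+ m / p%:R ^+ (j - i)) *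
                  scaledH p m r (n %/ p) (j - i).
Proof.
move=> pp; rewrite /scaledH (@H_rec p n j pp) mulr_sumr; apply: eq_bigr => i _.
by rewrite mulSn exprD exprVn; ring.
Qed.

(** For [j <= m] every power of [p] in the recurrence has exponent [m - (j - i) >= 0]. *)
Lemma scaledH_local (p m r n j : nat) : prime p ->
  (n %/ p ^ r)%N = m -> (j <= m)%N -> scaledH p m r n j \in plocal p.
Proof.
move=> pp; have p0 : (p%:R != 0 :> rat) by rewrite pnatr_eq0 -lt0n prime_gt0.
elim: r n j => [|r IH] n j.
  rewrite expn0 divn1 => -> _; rewrite /scaledH mul0n expr0 mulr1 fact_H.
  have /polyOverP : rising rat m \is a polyOver (plocal p); last by apply.
  by apply: rpred_prod => i _; rewrite rpredD ?polyOverX// polyOverC rpred_nat.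
rewrite expnS divnMA => nm jm; rewrite scaledH_rec//.
apply: rpred_sum => i _; have im : (j - i <= m)%N by lia.
rewrite -expfB_cond ?(negbTE p0)//.
apply: rpredM; last exact: IH.
by apply: rpredM; [exact: copoly_local | rewrite rpredX// rpred_nat].
Qed.

(** At [j = m] only the term [i = 0] of the recurrence survives mod [p]; for [r = 0] the value is
    the leading coefficient of [rising]. *)
Lemma scaledH_eq1 (p m r n : nat) : prime p ->
  (n %/ p ^ r)%N = m -> (scaledH p m r n m - 1) / p%:R \in plocal p.
Proof.
move=> pp; have p0 : (p%:R != 0 :> rat) by rewrite pnatr_eq0 -lt0n prime_gt0.
elim: r n => [|r IH] n.
  rewrite expn0 divn1 => ->; rewrite /scaledH mul0n expr0 mulr1 fact_H.
  by rewrite coef_rising subrr mul0r rpred0.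
rewrite expnS divnMA => nm; rewrite scaledH_rec// big_ord_recl/= subn0.
rewrite (copoly_coef01 p n).1 mul1r divff ?expf_neq0// mul1r addrAC mulrDl.
rewrite rpredD ?IH// mulr_suml rpred_sum// => i _.
have im : (m - bump 0 i <= m)%N by lia.
have -> : p%:R ^+ m / p%:R ^+ (m - bump 0 i) = p%:R * p%:R ^+ i :> rat.
  rewrite -expfB_cond ?(negbTE p0)// -exprS; congr (_ ^+ _).
  by rewrite /bump/=; have := ltn_ord i; lia.
rewrite [X in X \in _](_ : _ = (copoly p n)`_(bump 0 i) * p%:R ^+ i *
  scaledH p m r (n %/ p) (m - bump 0 i)); last by field.
apply: rpredM; last exact: scaledH_local.
by apply: rpredM; [exact: copoly_local | rewrite rpredX// rpred_nat].
Qed.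

(** The descent from [n] to [n %/ p]. At [j = m + 1] the term [i = 0] is [c], the term [i = 1] is
    the [p]-free harmonic sum times a factor congruent to 1, and the rest is divisible by [p]. *)
Lemma scaledH_div (p m r n : nat) : prime p -> (n %/ p ^ r.+1)%N = m ->
  scaledH p m r.+1 n m.+1 / p%:R \in plocal p ->
  let c := scaledH p m r (n %/ p) m.+1 / p%:R in
  (c \in plocal p) /\ ((c + (copoly p n)`_1) / p%:R \in plocal p).
Proof.
move=> pp; have p0 : (p%:R != 0 :> rat) by rewrite pnatr_eq0 -lt0n prime_gt0.
rewrite expnS divnMA => nm; rewrite scaledH_rec// !big_ord_recl/= subn0.
rewrite (copoly_coef01 p n).1 mul1r /bump/= add1n subSS subn0.
set S := \sum_(i < m) _; set c := scaledH _ _ _ _ _ / _.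
set u := scaledH p m r (n %/ p) m; set a := _`_1 => bad.
have Sp : S / p%:R \in plocal p.
  rewrite mulr_suml rpred_sum// => i _; rewrite !add1n subSS.
  have im : (m - i.+1 <= m)%N by lia.
  have -> : p%:R ^+ m / p%:R ^+ (m - i.+1) = p%:R * p%:R ^+ i :> rat.
    rewrite -expfB_cond ?(negbTE p0)// -exprS; congr (_ ^+ _).
    by have := ltn_ord i; lia.
  rewrite [X in X \in _](_ : _ = (copoly p n)`_(i.+2) * p%:R ^+ i *
    scaledH p m r (n %/ p) (m - i.+1)); last by field.
  apply: rpredM; last exact: scaledH_local.
by apply: rpredM; [exact: copoly_local | rewrite rpredX// rpred_nat].
have al : a \in plocal p by rewrite copoly_local.
have ul : (u - 1) / p%:R \in plocal p by rewrite scaledH_eq1.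
have h : (c + a) / p%:R \in plocal p.
  (* The recurrence sums to [c + a * u + S]; removing [S] and [a * (u - 1)] leaves [c + a]. *)
  rewrite [X in X \in _](_ : _ = (p%:R ^+ m / p%:R ^+ m.+1 *
    scaledH p m r (n %/ p) m.+1 + (a * (p%:R ^+ m / p%:R ^+ m) * u + S)) / p%:R -
    S / p%:R - a * ((u - 1) / p%:R)).
    by apply: rpredB; [apply: rpredB | apply: rpredM].
  have := expf_neq0 m p0; rewrite /c exprS; set y := _ ^+ _ => y0.
  by field; rewrite p0.
split=> //; rewrite [c](_ : _ = (c + a) / p%:R * p%:R - a); last by field.
by apply: rpredB => //; apply: rpredM => //; rewrite rpred_nat.
Qed.

(** * Sums of consecutive reciprocals and roots mod [p] *)

(* Clearing denominators turns [\sum_(l < j) 1 / (a + l + 1)] into the value at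
   [a] of the derivative of [\prod_(l < j) (X + l + 1)]. *)
Lemma rising_deriv_sum (p a j : nat) : exists2 M : nat,
  M%:R = (\sum_(l < j) (a + l.+1)%:R^-1) * (\prod_(l < j) (a + l.+1))%:R :> rat &
  M%:R = (rising 'F_p j)^`().[a%:R].
Proof.
have ev i : (rising 'F_p i).[a%:R] = (\prod_(l < i) (a + l.+1))%:R.
  rewrite /rising horner_prod natr_prod; apply: eq_bigr => l _.
  by rewrite hornerD hornerX hornerC natrD.
elim: j => [|j [M IH1 IH2]].
  by exists 0%N; rewrite /rising ?big_ord0 ?mul0r// derivC horner0.
exists (M * (a + j.+1) + \prod_(l < j) (a + l.+1))%N.
  rewrite natrD natrM IH1 !big_ord_recr/= natrM.
  have : ((a + j.+1)%:R != 0 :> rat) by rewrite pnatr_eq0 addnS.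
  by set y := (a + j.+1)%:R => y0; field.
rewrite natrD natrM IH2 risingS derivM derivD derivX derivC addr0 mulr1.
by rewrite hornerD hornerM ev hornerD hornerX hornerC [in LHS]natrD.
Qed.

(** The cleared sum [M] is a natural number divisible by [p] in Z_(p), hence in the integers, so it
    vanishes in ['F_p]. *)
Lemma root_rising_deriv (p a j : nat) : prime p ->
  (forall l, (l < j)%N -> ~~ (p %| a + l.+1)%N) ->
  (\sum_(l < j) (a + l.+1)%:R^-1) / p%:R \in plocal p ->
  root (rising 'F_p j)^`() a%:R.
Proof.
move=> pp na sp; have [M M1 M2] := rising_deriv_sum p a j.
rewrite /root -M2 -(dvdn_pcharf (pchar_Fp pp)); apply: plocal_nat_div => //.
by rewrite M1 mulrAC; apply: rpredM => //; rewrite rpred_nat.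
Qed.

(** The coefficient of degree [j - 1] in the derivative is [j], nonzero mod [p] since [0 < j < p];
    digits below [p] stay distinct in ['F_p]. *)
Lemma count_root_rising_deriv (p j : nat) (s : seq nat) : prime p ->
  (0 < j < p)%N -> uniq s -> {in s, forall d, (d < p)%N} ->
  {in s, forall d, root (rising 'F_p j)^`() d%:R} -> (size s <= j.-1)%N.
Proof.
move=> pp /andP[j0 jp] us sp rs.
have d0 : (rising 'F_p j)^`() != 0.
  apply/eqP => /(congr1 (fun q : {poly 'F_p} => q`_j.-1)).
  rewrite coef_deriv coef0 prednK// coef_rising => /eqP.
  by rewrite -(dvdn_pcharf (pchar_Fp pp)) gtnNdvd.
rewrite -ltnS prednK//.
have : (size (rising 'F_p j)^`() <= j)%N.
  rewrite -ltnS -(size_rising 'F_p j) lt_size_deriv//.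
  by rewrite -size_poly_eq0 size_rising.
apply: leq_trans; rewrite -(size_map (fun d => d%:R : 'F_p)).
apply: max_poly_roots => //.
  by apply/allP => _ /mapP[d ds ->]; apply: rs.
rewrite map_inj_in_uniq// => d e /sp dp /sp ep /(congr1 val)/=.
by rewrite !val_Fp_nat// !modn_small.
Qed.

Lemma copoly_coef1_add (p a d j : nat) : prime p -> (d + j < p)%N ->
  (copoly p (a * p + d + j))`_1 =
  (copoly p (a * p + d))`_1 + \sum_(l < j) (a * p + d + l.+1)%:R^-1.
Proof.
move=> pp; rewrite !(copoly_coef01 _ _).2.
elim: j => [|j IH] jp; first by rewrite addn0 big_ord0 addr0.
rewrite [in RHS]big_ord_recr/= addrA -IH; last by lia.
rewrite addnS big_mkcond big_ord_recr/= -big_mkcond/= -addnS.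
suff -> : ~~ (p %| a * p + d + j.+1)%N by [].
by rewrite -addnA dvdn_addr ?dvdn_mull// gtnNdvd// addnS.
Qed.

(** * Sets of digits in which each distance is rare *)

(** Each gap between neighbours is at least [M] minus its deficit, where a gap [j < M] has deficit
    [M - j]; summing the gaps telescopes. The superset [T] stays fixed while the induction shortens
    the list. *)
Lemma size_spread (M : nat) (T s : seq nat) (x : nat) : path ltn x s ->
  {subset x :: s <= T} ->
  (M * size s + x <= last x s +
    \sum_(1 <= j < M) (M - j) * count (fun e => (e + j) \in T) (x :: s))%N.
Proof.
elim: s x => [|y s IH] x; first by rewrite muln0 add0n leq_addr.
move=> /= /andP[xy ys] sT.
have /(IH _ ys) : {subset y :: s <= T} by move=> z zs; rewrite sT// inE zs orbT.
have -> : (\sum_(1 <= j < M)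
    (M - j) * (((x + j) \in T) + (((y + j) \in T) + count (fun e => (e + j) \in T) s)) =
  \sum_(1 <= j < M) (M - j) * ((x + j) \in T) +
  \sum_(1 <= j < M) (M - j) * count (fun e => (e + j) \in T) (y :: s))%N.
  by rewrite -big_split/=; apply: eq_bigr => j _; rewrite mulnDr.
set S := (X in (last y s + X)%N).
have : (M - (y - x) <= \sum_(1 <= j < M) (M - j) * ((x + j) \in T))%N.
  have [yM|] := ltnP (y - x) M; last by rewrite -subn_eq0 => /eqP ->.
  rewrite (bigD1_seq (y - x)%N) ?iota_uniq//=; last first.
    by rewrite mem_index_iota yM subn_gt0 xy.
  by rewrite (subnKC (ltnW xy)) sT ?inE ?eqxx ?orbT// muln1 leq_addr.
set U := (\sum_(1 <= j < M) (M - j) * ((x + j) \in T))%N.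
by rewrite -/S mulnS; move: (M * _)%N S U xy => A S U; lia.
Qed.

(** By the inequality of means, [4 * (M - j) * (j - 1) <= (M - 1) ^ 2] for each of the [M - 1]
    terms. *)
Lemma sum_spread (M : nat) (c : nat -> nat) :
  (forall j, (0 < j)%N -> c j <= j.-1)%N ->
  (4 * \sum_(1 <= j < M) (M - j) * c j <= M.-1 ^ 3)%N.
Proof.
move=> cj; rewrite big_distrr/=.
apply: (@leq_trans (\sum_(1 <= j < M) M.-1 ^ 2)).
  rewrite !big_nat; apply: leq_sum => j /andP[j0 jM].
  apply: (@leq_trans (4 * ((M - j) * j.-1))); first by rewrite !leq_mul// cj.
  have -> : (M.-1 = M - j + j.-1)%N by lia.
  by rewrite nat_AGM2.
by rewrite sum_nat_const_nat subn1 -expnS.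
Qed.

(** The hypothesis is what the two preceding bounds give for [N] digits. A choice of [M] near the
    cube root of [p] balances its terms. *)
Lemma size_leq_pow (p N : nat) : prime p ->
  (forall M, (1 < M)%N -> 4 * M * N <= 4 * p.-1 + 4 * M + M.-1 ^ 3)%N ->
  (N ^ 6 <= p ^ 5)%N.
Proof.
move=> pp hN; have p1 := prime_gt1 pp.
have [p27|p27] := ltnP p 27.
  (* For small [p] the choice [M = 2] suffices, leaving finitely many [N] with
     [N ^ 6 <= (2 * N - 1) ^ 5]. *)
  have N2 : (N.*2.-1 <= p)%N by have := hN 2 isT; rewrite exp1n; lia.
  apply: (@leq_trans (N.*2.-1 ^ 5)); last by rewrite leq_exp2r.
  have : (N < 14)%N by lia.
  by move: N {hN N2}; do 14 (case; first by lia).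
have [M /andP[Mp pM]] : exists M, (M ^ 3 <= p < M.+1 ^ 3)%N.
  have ex : exists n, (n ^ 3 <= p)%N by exists 0.
  have ub n : (n ^ 3 <= p -> n <= p)%N.
    by apply: leq_trans; case: n => // n; rewrite -{1}(expn1 n.+1) leq_pexp2l.
  have [M Mp Mm] := ex_maxnP ex ub; exists M; rewrite Mp ltnNge.
  by apply/negP => /Mm; rewrite ltnn.
have M3 : (3 <= M)%N.
  have : (3 ^ 3 < M.+1 ^ 3)%N by apply: leq_ltn_trans pM.
  by rewrite ltn_exp2r.
have h : (4 * M * N <= 5 * p)%N.
  have cube : (M.-1 ^ 3 + 4 * M <= M ^ 3 + 4)%N.
    by case: M M3 {Mp pM} => // n _ /=; rewrite !expnS expn0; nia.
  by move: (hN M (ltnW M3)) cube Mp; rewrite -mulnA; move: (M * N)%N; lia.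
have hp : (5 ^ 6 * p <= (4 * M) ^ 6)%N.
  apply: (@leq_trans (5 ^ 6 * M.+1 ^ 3)); first by rewrite leq_mul2l ltnW.
  (* Cubing this gives the claim. It holds from [M = 3] on, whence the threshold [27 = 3 ^ 3]. *)
  have : (25 * M.+1 <= 16 * M ^ 2)%N by rewrite -mulnn; nia.
  rewrite -(leq_exp2r _ _ (isT : 0 < 3)%N) (expnMn 25) (expnMn 16) -expnM.
  by rewrite (expnM 5 2 3) (expnMn 4 M 6) (expnM 4 2 3).
have M6 : (0 < (4 * M) ^ 6)%N by rewrite expn_gt0; lia.
rewrite -(leq_pmul2l M6) -expnMn.
apply: (@leq_trans ((5 * p) ^ 6)); first by rewrite leq_exp2r.
by rewrite expnMn (expnSr p) [(p ^ _ * _)%N]mulnC mulnA leq_mul.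
Qed.

(** If [d] and [d + j] both qualify, subtraction cancels [c] and leaves a block of [j] reciprocals
    divisible by [p], so [d] is one of at most [j - 1] roots. *)
Lemma size_digits_local (p a : nat) (c : rat) : prime p ->
  (size [seq d <- iota 0 p |
           (c + (copoly p (a * p + d))`_1) / p%:R \in plocal p] ^ 6 <= p ^ 5)%N.
Proof.
move=> pp; set P := fun d => _; set T := seq.filter P _.
have inT d : d \in T -> (d < p)%N /\ P d.
  by rewrite mem_filter mem_iota add0n => /andP[? /andP[]].
have uT : uniq T by rewrite filter_uniq// iota_uniq.
have sT : sorted ltn T by rewrite (sorted_filter ltn_trans)// iota_ltn_sorted.
have cT j : (0 < j)%N -> (count (fun e => (e + j) \in T) T <= j.-1)%N.
  move=> j0; have [pj|jp] := leqP p j.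
    rewrite -size_filter (_ : [seq e <- T | _] = [::])//; apply/eqP.
    rewrite -[_ == _]negbK -has_filter; apply/hasPn => e _.
    by apply/negP => /inT[]; lia.
  rewrite -size_filter; apply: (@count_root_rising_deriv p); rewrite ?j0//.
  - by rewrite filter_uniq.
  - by move=> d; rewrite mem_filter => /andP[_ /inT[]].
  move=> d; rewrite mem_filter => /andP[/inT[djp Pdj] /inT[dp Pd]].
  have -> : d%:R = (a * p + d)%:R :> 'F_p.
    by rewrite natrD natrM pchar_Fp_0// mulr0 add0r.
  apply: root_rising_deriv => // [l lj|].
    by rewrite -addnA dvdn_addr ?dvdn_mull// gtnNdvd//; lia.
  move: Pdj Pd; rewrite /P addnA copoly_coef1_add// => h1 h2.
  have := rpredB h1 h2; by rewrite -mulrBl addrA [X in X - _]addrC addrK.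
apply: size_leq_pow => // M M1.
have := @sum_spread M (fun j => count (fun e => (e + j) \in T) T) cT.
have := @size_spread M T; case: T inT sT {uT cT} => [|x s] inT sT.
  by rewrite muln0.
move=> /(_ s x sT (fun _ => id)).
have [lp _] := inT _ (mem_last x s).
rewrite -mulnA [size (_ :: _)]/= mulnS; set S := (\sum_(_ <= _ < _) _)%N.
move: (last x s) lp (M * size s)%N (M.-1 ^ 3)%N S => L lp A B S. lia.
Qed.

(** * Base-[p] digits and prefixes *)

(** Fuel beyond the number itself does not change the result. *)
Lemma digitsE (p n : nat) : (1 < p)%N -> (0 < n)%N ->
  digits p n = rcons (digits p (n %/ p)) (n %% p)%N.
Proof.
move=> p1; have fuel f k : (k <= f)%N -> digits_rec f p k = digits p k.
  rewrite /digits; elim/ltn_ind: k f => -[|k] IH [|f]// kf /=.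
  have lt_k : (k.+1 %/ p <= k)%N by rewrite -ltnS ltn_Pdiv.
  by rewrite (IH _ _ f) ?(IH _ _ k)// (leq_trans lt_k).
case: n => // n _; rewrite {1}/digits /= fuel//.
by rewrite -ltnS ltn_Pdiv.
Qed.

Lemma digits_inj (p : nat) : (1 < p)%N -> injective (digits p).
Proof.
move=> p1; apply: (can_inj (g := foldl (fun v d => v * p + d)%N 0%N)).
elim/ltn_ind => -[|n] IH //.
by rewrite digitsE// foldl_rcons IH ?ltn_Pdiv// -divn_eq.
Qed.

Lemma prefix_digits (p m n : nat) : (1 < p)%N ->
  prefix (digits p m) (digits p n) -> exists r, (n %/ p ^ r)%N = m.
Proof.
move=> p1; elim/ltn_ind: n => n IH mn.
have [e|ne] := eqVneq m n; first by exists 0%N; rewrite expn0 divn1 e.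
have [n0|n0] := posnP n.
  by move: mn ne; rewrite n0 prefixs0 => /eqP/(digits_inj p p1 m 0) ->.
have : prefix (digits p m) (digits p (n %/ p)).
  move: mn; rewrite (digitsE p n)// => /prefixP[t].
  case/lastP: t => [|t d].
    by rewrite cats0 -digitsE// => /(digits_inj p p1) e; rewrite e eqxx in ne.
  by rewrite -rcons_cat => /rcons_inj[-> _]; rewrite prefix_prefix.
by case/IH => [|r <-]; [rewrite ltn_Pdiv | exists r.+1; rewrite expnS divnMA].
Qed.

(** * From the valuation to a count of exceptions *)

Lemma plocal_nu_p (p e : nat) (q : rat) : prime p ->
  - e%:Z < nu_p p q -> p%:R ^+ e * q / p%:R \in plocal p.
Proof.
move=> pp; have p0 : (p%:R != 0 :> rat) by rewrite pnatr_eq0 -lt0n prime_gt0.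
have [->|q0] := eqVneq q 0; first by rewrite mulr0 mul0r rpred0.
have N0 : (0 < `|numq q|)%N by rewrite absz_gt0 numq_eq0.
have D0 : (0 < `|denq q|)%N by rewrite absz_gt0 denq_neq0.
have [N _ eN] := pfactor_coprime pp N0; have [D pD eD] := pfactor_coprime pp D0.
rewrite /nu_p; move: eN eD.
set u := logn p `|numq q|; set v := logn p `|denq q| => eN eD uv.
have Dn0 : (D%:R != 0 :> rat).
  by rewrite pnatr_eq0; apply: contraTneq D0 => D_0; rewrite eD D_0 mul0n.
have dE : denq q = (D * p ^ v)%N by rewrite -eD gez0_abs// denq_ge0.
(* The truncated subtraction [u + e - v.+1] is exact, since the hypothesis on [nu_p] says
   [v < u + e]. *)
suff -> : p%:R ^+ e * q / p%:R =
    (-1) ^+ (numq q < 0)%R * N%:R * p%:R ^+ (u + e - v.+1) / D%:R.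
  apply: rpredM; last exact: plocal_inv.
  apply: rpredM; last by rewrite rpredX// rpred_nat.
  by apply: rpredM; rewrite ?rpred_nat// rpredX// rpredN1.
rewrite -{1}(divq_num_den q) [numq q in LHS]intEsign eN dE.
rewrite expfB_cond ?(negbTE p0); last by lia.
rewrite rmorphM/= rmorphXn rmorphN1 -!pmulrn !natrM !natrX exprD exprS.
have := expf_neq0 v p0; set y := _ ^+ v => y0.
by field; rewrite Dn0 y0 p0.
Qed.

Lemma size_fibers (T U : eqType) (g : T -> U) (s : seq T) (t : seq U) (f : nat) :
  {in s, forall x, g x \in t} ->
  (forall y, size [seq x <- s | g x == y] <= f)%N -> (size s <= f * size t)%N.
Proof.
move=> + sf; elim: t s sf => [|y t IH] s sf st.
  by case: s st {sf} => // x s /(_ x); rewrite inE eqxx => /(_ isT).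
rewrite -(count_predC (fun x => g x == y)) -!size_filter mulnS leq_add//.
apply: IH => [z|x].
  apply: leq_trans (sf z); rewrite -filter_predI !size_filter.
  by apply: sub_count => x /= /andP[].
by rewrite mem_filter /= => /andP[/negbTE xy /st]; rewrite inE xy.
Qed.

(** Here [m] is [k - 1] and [r] counts the digits after the prefix. The second condition is a
    consequence of the failure of the inequality. *)
Definition bad (p m r n : nat) : bool :=
  ((n %/ p ^ r)%N == m) && (scaledH p m r n m.+1 / p%:R \in plocal p).

(** Division by [p] maps level [r + 1] to level [r]; the fibre over [a] embeds by its last digit
    into a set bounded by [size_digits_local], and level 0 contains at most [m]. *)
Lemma size_bad (p m r f : nat) : prime p ->
  (forall N, N ^ 6 <= p ^ 5 -> N <= f)%N ->
  (size [seq n <- iota 0 (m.+1 * p ^ r) | bad p m r n] <= f ^ r)%N.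
Proof.
move=> pp hf; have p0 := prime_gt0 pp; elim: r => [|r IH].
  rewrite expn0; apply: (@uniq_leq_size _ _ [:: m]).
    by rewrite filter_uniq// iota_uniq.
  by move=> n; rewrite mem_filter /bad expn0 divn1 mem_seq1 => /andP[/andP[]].
rewrite (expnS f); apply: leq_trans (leq_mul (leqnn f) IH).
apply: (@size_fibers _ _ (fun n => n %/ p)%N) => [n|a].
  rewrite !mem_filter !mem_iota !add0n /= /bad => /andP[/andP[/eqP nm nb] nl].
  rewrite ltn_divLR// -mulnA -expnSr nl -divnMA -expnS nm eqxx /= andbT.
  by have [] := scaledH_div p m r n pp nm nb.
apply: hf; set s := seq.filter _ _.
pose c := scaledH p m r a m.+1 / p%:R.
apply: leq_trans (size_digits_local p a c pp); rewrite leq_exp2r//.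
rewrite -(size_map (modn^~ p) s); apply: uniq_leq_size.
  rewrite map_inj_in_uniq ?filter_uniq ?iota_uniq// => i j.
  rewrite !(mem_filter, mem_iota) => /andP[/eqP ia _] /andP[/eqP ja _] ij.
  by rewrite (divn_eq i p) (divn_eq j p) ia ja ij.
move=> _ /mapP[n + ->]; rewrite !mem_filter => /andP[/eqP na /andP[/andP[/eqP nm nb] _]].
rewrite mem_iota add0n ltn_mod p0 -{1}na -divn_eq !andbT /c -na.
by have [] := scaledH_div p m r n pp nm nb.
Qed.

(** * Real estimates and the final bound *)

(** For [b >= 1] the exponent 5/6 may be raised to 0.835. *)
Lemma powR_root_le (R : realType) (a b : R) : 0 <= a -> 1 <= b ->
  a ^+ 6 <= b ^+ 5 -> a <= b `^ (835%:R / 1000%:R).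
Proof.
move=> a0 b1 ab; have b0 : 0 <= b by lra.
have -> : a = (a ^+ 6) `^ 6^-1.
  by rewrite -powR_mulrn// -powRrM mulfV ?powRr1// pnatr_eq0.
apply: (@le_trans _ _ ((b ^+ 5) `^ 6^-1)).
  by rewrite ge0_ler_powR// nnegrE exprn_ge0.
by rewrite -powR_mulrn// -powRrM ler_powR//; lra.
Qed.

(** The induction step [3 * q ^ s + q ^ (s + 1) <= 3 * q ^ (s + 1)] amounts to [q >= 3 / 2]; this is
    the source of the constant 3. *)
Lemma sum_geom_le (R : realFieldType) (q : R) (s : nat) : 3 / 2 <= q ->
  \sum_(r < s.+1) q ^+ r <= 3 * q ^+ s.
Proof.
move=> q32; elim: s => [|s IH]; first by rewrite big_ord1 expr0; lra.
rewrite big_ord_recr/= (le_trans (lerD IH (lexx _)))// exprS.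
have : 0 <= q ^+ s by rewrite exprn_ge0//; lra.
by nra.
Qed.

Theorem theorem2p2 (R : realType) (p k : nat) (x : R) :
  prime p -> (2 <= k)%N -> ((k.-1 * p)%:R <= x) ->
  (size [seq n <- iota 0 (Num.truncn x).+1 |
           [&& (k.-1 * p <= n)%N, n%:R <= x,
               prefix (digits p k.-1) (digits p n) &
               ~~ ((nu_p p (H n k))%:~R <
                   - (k.-1%:R * (logb p (n%:R : R) - logb p (k.-1%:R) - 1)))]])%:R
  <= 3 * x `^ (835%:R / 1000%:R).
Proof.
move=> pp k2 mx; have p1 := prime_gt1 pp; have p0 := prime_gt0 pp.
case: k k2 mx => // m m1; rewrite ltnS in m1; rewrite [_.+1.-1]/= => mx.
have m0 : (0 < m%:R :> R) by rewrite ltr0n.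
have x0 : 0 <= x by apply: le_trans mx.
set L := seq.filter _ _; pose s := trunc_log p (Num.truncn x).
(* [f] is the integer part of [p ^ (5/6)]. *)
have [f fm hf] : exists2 f, (f ^ 6 <= p ^ 5)%N & forall N, (N ^ 6 <= p ^ 5 -> N <= f)%N.
  have ex : exists n, (n ^ 6 <= p ^ 5)%N by exists 0%N.
  have ub n : (n ^ 6 <= p ^ 5 -> n <= p ^ 5)%N.
    by apply: leq_trans; case: n => // n; rewrite -{1}(expn1 n.+1) leq_pexp2l.
  by have [f fm fM] := ex_maxnP ex ub; exists f.
have tx : (m * p <= Num.truncn x)%N by rewrite truncn_ge_nat.
have LB : {subset L <= flatten [seq [seq n <- iota 0 (m.+1 * p ^ r) | bad p m r n]
                           | r <- iota 0 s.+1]}.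
  move=> n; rewrite mem_filter => /andP[/and4P[mn nx /(prefix_digits p m n p1)[r nr]]].
  rewrite -leNgt => nu _; apply/flattenP.
  have n0 : (0 < n)%N by apply: leq_trans mn; rewrite muln_gt0 m1.
  have nlt : (n < m.+1 * p ^ r)%N by rewrite -ltn_divLR ?expn_gt0 ?p0// nr.
  have nle : (m * p ^ r <= n)%N by rewrite -nr leq_trunc_div.
  have rs : (r <= s)%N.
    apply: trunc_log_max => //; rewrite truncn_ge_nat//; apply: le_trans nx.
    by rewrite ler_nat; apply: leq_trans nle; rewrite leq_pmull.
  exists [seq n <- iota 0 (m.+1 * p ^ r) | bad p m r n].
    by apply/mapP; exists r => //; rewrite mem_iota.
  rewrite mem_filter mem_iota nlt andbT /bad nr eqxx andTb leq0n andbT /scaledH.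
  rewrite -!mulrA; apply: rpredM; first by rewrite rpred_nat.
  rewrite mulrA; apply: plocal_nu_p => //.
  rewrite -(ltr_int R); apply: lt_le_trans nu.
  rewrite rmorphN/= -pmulrn ltrN2 natrM [r%:R * _]mulrC ltr_pM2l//.
  have lp : 0 < ln (p%:R : R) by rewrite ln_gt0// ltr1n.
  rewrite /logb -mulrBl ltrBlDr ltr_pdivrMr// ltrBlDr.
  have -> : (r%:R + 1) * ln (p%:R : R) = ln (p%:R ^+ r.+1).
    by rewrite lnXn ?ltr0n// natr1 mulr_natl.
  rewrite -lnM ?posrE ?exprn_gt0 ?ltr0n//.
  rewrite ltr_ln ?posrE ?mulr_gt0 ?exprn_gt0 ?ltr0n//.
  (* What remains is [n < m * p ^ (r + 1)], which follows from [n < (m + 1) * p ^ r] and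
     [m + 1 <= m * p]. *)
  rewrite -natrX -natrM ltr_nat; apply: (leq_trans nlt).
  by rewrite expnS mulnAC leq_mul2r; nia.
have sL : (size L <= \sum_(r < s.+1) f ^ r)%N.
  apply: leq_trans (uniq_leq_size _ LB) _; first by rewrite filter_uniq// iota_uniq.
  rewrite size_flatten /shape -map_comp sumnE big_map -(big_mkord xpredT) /index_iota subn0.
  by apply: leq_sum => r _; apply: size_bad.
pose q : R := p%:R `^ (835%:R / 1000%:R).
have fq : f%:R <= q.
  by apply: powR_root_le; rewrite ?ler1n// -!natrX ler_nat.
have q32 : 3 / 2 <= q.
  apply: powR_root_le; rewrite ?ler1n//.
  (* [(3 / 2) ^ 6 < 12 < 2 ^ 5 <= p ^ 5]. *)
  apply: (@le_trans _ _ (2 ^+ 5)); first by rewrite !exprS !expr0; lra.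
  by rewrite -!natrX ler_nat leq_exp2r.
apply: (@le_trans _ _ (\sum_(r < s.+1) q ^+ r)).
  apply: (@le_trans _ _ (\sum_(r < s.+1) f ^ r)%N%:R); first by rewrite ler_nat.
  by rewrite natr_sum; apply: ler_sum => r _; rewrite natrX lerXn2r ?nnegrE ?powR_ge0.
apply: le_trans (sum_geom_le R q s q32) _; rewrite ler_pM2l//.
(* Exchanging exponents turns [q ^ s] into the power 0.835 of [p ^ s], and [p ^ s <= x] by the
   choice of [s]. *)
rewrite -powR_mulrn ?powR_ge0// -powRrM mulrC powRrM powR_mulrn//.
have e0 : 0 <= 835%:R / 1000%:R :> R by lra.
apply: (ge0_ler_powR e0); rewrite ?nnegrE ?exprn_ge0//.
have tx0 : (0 < Num.truncn x)%N by apply: leq_trans tx; rewrite muln_gt0 m1.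
rewrite -natrX; apply: (@le_trans _ _ (Num.truncn x)%:R); last first.
  by rewrite -truncn_ge_nat.
by rewrite ler_nat trunc_logP.
Qed.
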